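(* Let $\boldsymbol{L}\in\mathbb{R}^{n_z\times n_z}$ be lower triangular, $\boldsymbol{K}\in\mathbb{R}^{n_z\times n_z}$ arbitrary, $\boldsymbol{W}\in\mathbb{R}^{n_z\times r}$ with $r\le n_z$, and let $\epsilon_s>0$ and $\epsilon_d\ge 0$. Define $$\boldsymbol{S}=\boldsymbol{L}\boldsymbol{L}^{\top}+\epsilon_s\boldsymbol{I}_{n_z},\qquad \boldsymbol{J}=\boldsymbol{K}-\boldsymbol{K}^{\top},\qquad \boldsymbol{R}=\boldsymbol{W}\boldsymbol{W}^{\top}+\epsilon_d\boldsymbol{I}_{n_z},\qquad \boldsymbol{A}_c=\boldsymbol{S}^{-1}(\boldsymbol{J}-\boldsymbol{R}),$$ let $\boldsymbol{B}_c\in\mathbb{R}^{n_z\times m}$ be the lifted input matrix defined in the context, let $\tilde{H}(\boldsymbol{z})=\tfrac12\boldsymbol{z}^{\top}\boldsymbol{S}\boldsymbol{z}$, and let $h>0$. If $\epsilon_d>0$, then $\boldsymbol{R}\succeq\epsilon_d\boldsymbol{I}_{n_z}\succ 0$, and the following hold. (i) Along every solution of $\dot{\boldsymbol{z}}=\boldsymbol{A}_c\boldsymbol{z}+\boldsymbol{B}_c\boldsymbol{u}$, with $\tilde{\boldsymbol{y}}=\boldsymbol{B}_c^{\top}\boldsymbol{S}\boldsymbol{z}$, $$\dot{\tilde{H}}\le \tilde{\boldsymbol{y}}^{\top}\boldsymbol{u}-\epsilon_d\|\boldsymbol{z}\|_2^2 .$$ (ii) Whenever $\boldsymbol{z}_k,\boldsymbol{z}_{k+1}\in\mathbb{R}^{n_z}$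 and $\boldsymbol{u}_k\in\mathbb{R}^m$ satisfy $\frac{\boldsymbol{z}_{k+1}-\boldsymbol{z}_k}{h}=\boldsymbol{A}_c\bar{\boldsymbol{z}}_k+\boldsymbol{B}_c\boldsymbol{u}_k$ with $\bar{\boldsymbol{z}}_k=\frac{\boldsymbol{z}_{k+1}+\boldsymbol{z}_k}{2}$, and $\bar{\boldsymbol{y}}_k=\boldsymbol{B}_c^{\top}\boldsymbol{S}\bar{\boldsymbol{z}}_k$, $$\tilde{H}(\boldsymbol{z}_{k+1})-\tilde{H}(\boldsymbol{z}_k)\le h\,\bar{\boldsymbol{y}}_k^{\top}\boldsymbol{u}_k-h\,\epsilon_d\|\bar{\boldsymbol{z}}_k\|_2^2 .$$ (iii) The discrete transition matrix $\boldsymbol{A}=\left(\boldsymbol{I}_{n_z}-\tfrac{h}{2}\boldsymbol{A}_c\right)^{-1}\left(\boldsymbol{I}_{n_z}+\tfrac{h}{2}\boldsymbol{A}_c\right)$ satisfies $\boldsymbol{A}^{\top}\boldsymbol{S}\boldsymbol{A}-\boldsymbol{S}\prec 0$, and therefore $\rho(\boldsymbol{A})<1$.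
   Context: All matrices are real. The dimension is $n_z=2n_q+n_\phi$, where $n_q$ is the number of generalized coordinates of a mechanical system and $n_\phi$ is the number of additional lifting functions. The lifted input matrix is $$\boldsymbol{B}_c=\begin{bmatrix}\boldsymbol{0}_{n_q\times m}\\ \boldsymbol{S}_a\\ \boldsymbol{0}_{n_\phi\times m}\end{bmatrix}\in\mathbb{R}^{n_z\times m},$$ where $\boldsymbol{S}_a\in\mathbb{R}^{n_q\times m}$ is a given constant matrix (the generalized-force distribution matrix). $\succ 0$, $\succeq$, $\prec 0$ refer to the Loewner order on symmetric matrices; $\rho(\cdot)$ is the spectral radius; $\|\cdot\|_2$ is the Euclidean norm; $\dot{\tilde H}$ is the time derivative of $\tilde H(\boldsymbol{z}(t))$. The matrix $\boldsymbol{I}_{n_z}-\frac{h}{2}\boldsymbol{A}_c$ is nonsingular for every $h>0$ under these definitions, so $\boldsymbol{A}$ is well defined. *)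

(* Defs.v *)
From mathcomp Require Export all_boot all_order all_algebra.
From mathcomp Require Export all_classical all_reals all_analysis.
From mathcomp Require Export complex.

Set Implicit Arguments.
Unset Strict Implicit.
Unset Printing Implicit Defensive.

Export Order.TTheory GRing.Theory Num.Theory numFieldNormedType.Exports.

#[global] Open Scope classical_set_scope.
#[global] Open Scope ring_scope.

(* n_z = 2 n_q + n_phi, split as (n_q, (n_q, n_phi)) to match the three row
   blocks of the lifted input matrix. *)
Definition lifted_dim (nq nphi : nat) : nat := (nq + (nq + nphi))%N.

Definition lifted_input (R : realType) (nq nphi m : nat) (Sa : 'M[R]_(nq, m)) :
    'M[R]_(lifted_dim nq nphi, m) :=
  col_mx 0 (col_mx Sa 0).

Definition dotv (R : realType) (n : nat) (x y : 'cV[R]_n) : R :=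
  (x^T *m y) 0 0.

(* The norm `|x| carried by column vectors in the library is the sup norm. *)
Definition norm2 (R : realType) (n : nat) (x : 'cV[R]_n) : R :=
  Num.sqrt (\sum_(i < n) x i 0 ^+ 2).

Definition loewner_le (R : realType) (n : nat) (M N : 'M[R]_n) : Prop :=
  [/\ M^T = M, N^T = N & forall x : 'cV[R]_n, 0 <= dotv x ((N - M) *m x)].

Definition loewner_lt (R : realType) (n : nat) (M N : 'M[R]_n) : Prop :=
  [/\ M^T = M, N^T = N &
      forall x : 'cV[R]_n, x != 0 -> 0 < dotv x ((N - M) *m x)].

(* Largest modulus of a complex eigenvalue of the real matrix A; the set is
   finite, and nonempty as soon as n > 0 (for n = 0 the value is 0). *)
Definition spectral_radius (R : realType) (n : nat) (A : 'M[R]_n) : R :=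
  sup [set Normc.normc lambda | lambda in
        [set lambda : R[i] | eigenvalue (map_mx (real_complex R) A) lambda]].

(* d is the derivative at t of f restricted to J: one-sided at an endpoint
   belonging to J, the usual derivative in the interior of J. *)
Definition is_derive_within (R : realType) (V : normedModType R)
    (J : interval R) (f : R -> V) (t : R) (d : V) : Prop :=
  s^-1 *: (f (s + t) - f t)
    @[s --> within [set s | s + t \in J] (0 : R)^'] --> d.

Definition nondegenerate (R : realType) (J : interval R) : Prop :=
  exists a b : R, [/\ a < b, a \in J & b \in J].

(* z' = A z + B u on the time interval J, J possibly unbounded and with or
   without its endpoints. *)
Definition is_solution (R : realType) (n m : nat) (A : 'M[R]_n)
    (B : 'M[R]_(n, m)) (J : interval R) (u : R -> 'cV[R]_m)
    (z : R -> 'cV[R]_n) : Prop :=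
  forall t : R, t \in J ->
    is_derive_within J z t (A *m z t + B *m u t).

Definition energy (R : realType) (n : nat) (S : 'M[R]_n) (z : 'cV[R]_n) : R :=
  2^-1 * dotv z (S *m z).

(* Main.v *)
Require Import Defs.
From mathcomp Require Import ring lra.

(** Since [S Ac = J - Rd] with [J] skew, the power [x^T S Ac x] equals
    [- x^T Rd x <= - eps_d |x|^2].  For a symmetric [S] the polarization
    [H y - H x = (1/2 (y + x))^T S (y - x)] turns this into the continuous
    estimate (as the increment goes to 0) and into the midpoint estimate (with
    the midpoint rule substituted for [y - x]).  The midpoint rule without input
    is [y = A x], which yields the Lyapunov inequality; the latter bounds every
    eigenvalue [a + ib] of [A] by [a^2 + b^2 < 1] on adding it over the real and
    imaginary parts of an eigenvector. *)

Set Implicit Arguments.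
Unset Strict Implicit.
Unset Printing Implicit Defensive.

(** * The Euclidean product and the derivative of a quadratic energy *)

Section EuclideanProduct.
Variable R : realType.

Lemma dotvC n (x y : 'cV[R]_n) : dotv x y = dotv y x.
Proof. by rewrite /dotv -[in LHS](trmxK y) -trmx_mul mxE. Qed.

Lemma dotvDl n (x y w : 'cV[R]_n) : dotv (x + y) w = dotv x w + dotv y w.
Proof. by rewrite /dotv linearD /= mulmxDl mxE. Qed.

Lemma dotvZl n a (x w : 'cV[R]_n) : dotv (a *: x) w = a * dotv x w.
Proof. by rewrite /dotv linearZ /= -scalemxAl mxE. Qed.

Lemma dotvNl n (x w : 'cV[R]_n) : dotv (- x) w = - dotv x w.
Proof. by rewrite -scaleN1r dotvZl mulN1r. Qed.

Lemma dotvDr n (x y w : 'cV[R]_n) : dotv w (x + y) = dotv w x + dotv w y.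
Proof. by rewrite !(dotvC w) dotvDl. Qed.

Lemma dotvZr n a (x w : 'cV[R]_n) : dotv w (a *: x) = a * dotv w x.
Proof. by rewrite !(dotvC w) dotvZl. Qed.

Lemma dotvNr n (x w : 'cV[R]_n) : dotv w (- x) = - dotv w x.
Proof. by rewrite !(dotvC w) dotvNl. Qed.

Lemma dotv0r n (w : 'cV[R]_n) : dotv w 0 = 0.
Proof. by rewrite /dotv mulmx0 mxE. Qed.

Lemma dotv_mulmxr n p (M : 'M[R]_(n, p)) x y :
  dotv x (M *m y) = dotv (M^T *m x) y.
Proof. by rewrite /dotv trmx_mul trmxK mulmxA. Qed.

Lemma dotvv n (x : 'cV[R]_n) : dotv x x = \sum_(i < n) x i 0 ^+ 2.
Proof. by rewrite /dotv mxE; apply: eq_bigr => i _; rewrite mxE expr2. Qed.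

Lemma dotvv_ge0 n (x : 'cV[R]_n) : 0 <= dotv x x.
Proof. by rewrite dotvv sumr_ge0 // => i _; rewrite sqr_ge0. Qed.

Lemma dotvv_gt0 n (x : 'cV[R]_n) : x != 0 -> 0 < dotv x x.
Proof.
move=> x0; rewrite lt_def dotvv_ge0 andbT; apply: contraNneq x0.
rewrite dotvv => /eqP; rewrite psumr_eq0 => [/allP x0|i _]; last exact: sqr_ge0.
apply/eqP/matrixP => i j; rewrite (ord1 j) [RHS]mxE; apply/eqP.
by move: (x0 i (mem_index_enum i)); rewrite sqrf_eq0.
Qed.

Lemma norm2_sqr n (x : 'cV[R]_n) : norm2 x ^+ 2 = dotv x x.
Proof. by rewrite /norm2 -dotvv sqr_sqrtr // dotvv_ge0. Qed.

Lemma dotv_gram n p (M : 'M[R]_(n, p)) x :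
  dotv x (M *m M^T *m x) = dotv (M^T *m x) (M^T *m x).
Proof. by rewrite -mulmxA dotv_mulmxr. Qed.

Lemma dotv_skew n (K : 'M[R]_n) x : dotv x ((K - K^T) *m x) = 0.
Proof.
rewrite mulmxBl dotvDr dotvNr [X in _ - X]dotv_mulmxr trmxK.
by rewrite [X in _ - X]dotvC subrr.
Qed.

Lemma energyB n (S : 'M[R]_n) (x y : 'cV[R]_n) : S^T = S ->
  energy S y - energy S x = dotv (2^-1 *: (y + x)) (S *m (y - x)).
Proof.
move=> SS; rewrite /energy mulmxBr dotvZl !(dotvDl, dotvDr, dotvNr).
have -> : dotv y (S *m x) = dotv x (S *m y) by rewrite dotv_mulmxr SS dotvC.
ring.
Qed.

(** In coordinates the form is a finite sum of products, so the limit is taken entry by entry. *)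
Lemma cvg_dotv_mulmx (T : Type) (F : set_system T) n p (M : 'M[R]_(n, p))
    (f : T -> 'cV[R]_n) (g : T -> 'cV[R]_p) a b :
  Filter F -> f x @[x --> F] --> a -> g x @[x --> F] --> b ->
  dotv (f x) (M *m g x) @[x --> F] --> dotv a (M *m b).
Proof.
move=> FF fa gb.
have dotvE (v : 'cV[R]_n) (w : 'cV[R]_p) :
    dotv v (M *m w) = \sum_(i < n) v i 0 * \sum_(j < p) M i j * w j 0.
  by rewrite /dotv mxE; apply: eq_bigr => i _; rewrite !mxE.
have coord q (k : T -> 'cV[R]_q) (c : 'cV[R]_q) i :
    k x @[x --> F] --> c -> k x i 0 @[x --> F] --> c i 0.
  by move=> kc; exact: (cvg_comp k (fun v => v i 0) kc (@coord_continuous _ _ _ i 0 c)).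
rewrite (_ : (fun x => _) = (fun x => \sum_(i < n) f x i 0 *
    \sum_(j < p) M i j * g x j 0)); last by apply/funext => x; exact: dotvE.
rewrite dotvE; apply: cvg_big => [|i _]; first exact: add_continuous.
apply: cvgM; first exact: coord.
apply: cvg_big => [|j _]; first exact: add_continuous.
by apply: cvgM; [exact: cvg_cst|exact: coord].
Qed.

(** By [energyB] the difference quotient of the energy is the form [S] applied to the midpoint of
    [z t] and [z (s + t)] and to the difference quotient of [z]. Both converge along the filter, so
    one-sided derivatives are covered too. *)
Lemma is_derive_within_energy n (S : 'M[R]_n) (J : interval R)
    (z : R -> 'cV[R]_n) (t : R) (d : 'cV[R]_n) : S^T = S ->
  is_derive_within J z t d ->
  is_derive_within J (energy S \o z : R -> R^o) t (dotv (z t) (S *m d)).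
Proof.
move=> SS; rewrite /is_derive_within; set F := within _ _ => zd.
have FF : Filter F by apply: within_filter.
have s0 : (fun s : R => s) @ F --> (0 : R).
  apply: cvg_trans (@nbhs_dnbhs R 0).
  exact: cvg_within.
have FN0 : F (fun s => s != 0).
  exact: (@cvg_within _ _ _ _ _ (@nbhs_dnbhs_neq R 0)).
(* Continuity of [z] at [t] within [J]: for [s != 0], [z (s + t)] is [s] times the difference
   quotient plus [z t]. *)
have zt : z (s + t) @[s --> F] --> z t.
  have : (s *: (s^-1 *: (z (s + t) - z t)) + z t) @[s --> F] --> 0 *: d + z t.
    by apply: cvgD; [exact: cvgZ|exact: cvg_cst].
  rewrite scale0r add0r; apply: cvg_trans; apply: near_eq_cvg.
  by near=> s => /=; rewrite scalerA divff ?scale1r ?subrK //; near: s.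
have midz : 2^-1 *: (z (s + t) + z t) @[s --> F] --> z t.
  rewrite -[X in _ --> X](_ : 2^-1 *: (z t + z t) = z t).
    by apply: cvgZ; [exact: cvg_cst|apply: cvgD; [|exact: cvg_cst]].
  by rewrite -mulr2n -[z t *+ 2]scaler_nat scalerK // pnatr_eq0.
have := @cvg_dotv_mulmx _ _ _ _ S _ _ _ _ FF midz zd.
rewrite (_ : (fun s => dotv _ _) = (fun s : R =>
  s^-1 *: ((energy S \o z : R -> R^o) (s + t) - energy S (z t)))) //.
by apply/funext => s /=; rewrite energyB // -scalemxAr dotvZr.
Unshelve. all: by end_near.
Qed.

End EuclideanProduct.

(** * Lyapunov inequality and spectral radius *)

Section Stability.
Variable R : realType.

Lemma inj_unitmx n (M : 'M[R]_n) :
  (forall x : 'cV[R]_n, M *m x = 0 -> x = 0) -> M \in unitmx.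
Proof.
move=> Minj; rewrite -unitmx_tr -row_free_unit; apply: inj_row_free => v vM.
by apply: trmx_inj; rewrite trmx0; apply: Minj; rewrite -[M]trmxK -trmx_mul vM trmx0.
Qed.

Lemma loewner_gt0_unitmx n (S : 'M[R]_n) : loewner_lt 0 S -> S \in unitmx.
Proof.
case=> _ _ Spos; apply: inj_unitmx => x Sx; apply/eqP; apply: contraT => /Spos.
by rewrite subr0 Sx dotv0r ltxx.
Qed.

(* [eigenvalue] is defined through row eigenvectors. *)
Lemma eigenvalue_right (F : fieldType) n (M : 'M[F]_n) a :
  eigenvalue M a -> exists2 x : 'cV[F]_n, x != 0 & M *m x = a *: x.
Proof.
rewrite /eigenvalue /eigenspace kermx_eq0 row_free_unit -unitmx_tr -row_free_unit.
rewrite -kermx_eq0 => /rowV0Pn[v /sub_kermxP vM v0]; exists v^T.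
  by rewrite -trmx0 (inj_eq trmx_inj).
apply/eqP; rewrite -subr_eq0 -mul_scalar_mx -mulmxBl; apply/eqP/trmx_inj.
by rewrite trmx_mul trmxK vM trmx0.
Qed.

(** Taking real and imaginary parts of a complex eigenvector keeps the later estimates within the
    real form of [S]. *)
Lemma real_eigenplane n (A : 'M[R]_n) (a b : R) :
  eigenvalue (map_mx (real_complex R) A) (Complex a b) ->
  exists x y : 'cV[R]_n, [/\ (x != 0) || (y != 0),
    A *m x = a *: x - b *: y & A *m y = b *: x + a *: y].
Proof.
case/eigenvalue_right => w w0 Aw.
exists (map_mx (@complex.Re R) w), (map_mx (@complex.Im R) w); split.
- rewrite -negb_and; apply: contra w0 => /andP[/eqP/matrixP Rw /eqP/matrixP Iw].
  apply/eqP/matrixP => i j; move: (Rw i j) (Iw i j); rewrite !mxE.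
  by case: (w i j) => ? ? /= -> ->.
- apply/matrixP => i j; move/matrixP/(_ i j)/(congr1 (@complex.Re R)): Aw.
  rewrite !mxE raddf_sum /= => Aw.
  (* The entries of [A] are real, so taking real parts commutes with multiplying by them. *)
  transitivity (\sum_(k < n) complex.Re (map_mx (real_complex R) A i k * w k j)).
    by apply: eq_bigr => k _; rewrite !mxE; case: (w k j) => c d /=; ring.
  by rewrite Aw; case: (w i j) => c d /=; ring.
- apply/matrixP => i j; move/matrixP/(_ i j)/(congr1 (@complex.Im R)): Aw.
  rewrite !mxE raddf_sum /= => Aw.
  transitivity (\sum_(k < n) complex.Im (map_mx (real_complex R) A i k * w k j)).
    by apply: eq_bigr => k _; rewrite !mxE; case: (w k j) => c d /=; ring.
  by rewrite Aw; case: (w i j) => c d /=; ring.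
Qed.

Lemma lyapunov_decrease n (S A : 'M[R]_n) x :
  dotv x ((0 - (A^T *m S *m A - S)) *m x) =
  dotv x (S *m x) - dotv (A *m x) (S *m (A *m x)).
Proof.
rewrite sub0r opprB mulmxBl dotvDr dotvNr -!mulmxA.
by rewrite (dotv_mulmxr A^T) trmxK.
Qed.

Lemma lyapunov_spectral_radius_lt1 n (S A : 'M[R]_n) :
  loewner_lt 0 S -> loewner_lt (A^T *m S *m A - S) 0 -> spectral_radius A < 1.
Proof.
move=> [_ SS Spos] [_ _ Apos].
have q_ge0 x : 0 <= dotv x (S *m x).
  have [->|/Spos] := eqVneq x 0; first by rewrite mulmx0 dotv0r.
  by rewrite subr0 => /ltW.
have q_lt x : x != 0 -> dotv (A *m x) (S *m (A *m x)) < dotv x (S *m x).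
  by move=> /Apos; rewrite lyapunov_decrease subr_gt0.
have eig_lt1 lambda : eigenvalue (map_mx (real_complex R) A) lambda ->
    Normc.normc lambda < 1.
  case: lambda => a b /real_eigenplane[x [y [xy Ax Ay]]] /=.
  rewrite -sqrtr1 ltr_sqrt //.
  have : dotv (A *m x) (S *m (A *m x)) + dotv (A *m y) (S *m (A *m y)) <
         dotv x (S *m x) + dotv y (S *m y).
    (* One of [x], [y] may vanish; for it only the weak inequality holds. *)
    have q_le u : dotv (A *m u) (S *m (A *m u)) <= dotv u (S *m u).
      have [->|/q_lt/ltW//] := eqVneq u 0; by rewrite !mulmx0.
    by case/orP: xy => /q_lt ?; [apply: ltr_leD|apply: ler_ltD].
  have Syx : dotv y (S *m x) = dotv x (S *m y) by rewrite dotv_mulmxr SS dotvC.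
  rewrite Ax Ay; set qx := dotv x (S *m x); set qy := dotv y (S *m y).
  (* Symmetry of [S] cancels the mixed terms and leaves the squared modulus of the eigenvalue as a
     factor. *)
  have -> : dotv (a *: x - b *: y) (S *m (a *: x - b *: y)) +
      dotv (b *: x + a *: y) (S *m (b *: x + a *: y)) =
      (a ^+ 2 + b ^+ 2) * (qx + qy).
    rewrite !mulmxDr !mulmxN -!scalemxAr !(dotvDl, dotvDr, dotvNl, dotvNr, dotvZl, dotvZr).
    by rewrite Syx -/qx -/qy; ring.
  have : 0 < qx + qy.
    by case/orP: xy => /Spos; rewrite subr0 => ?; [apply: ltr_wpDr|apply: ltr_wpDl];
      rewrite ?q_ge0.
  by move=> q0; rewrite -[X in _ < X -> _]mul1r ltr_pM2r.
rewrite /spectral_radius; set E := [set _ | _ in _].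
(* Without eigenvalues the supremum takes its default value 0. *)
have [->|/set0P E0] := eqVneq E set0; first by rewrite sup0.
(* A strict bound on each eigenvalue survives the supremum because the spectrum is finite: the roots
   of the characteristic polynomial form a list, whose maximum is still below 1. *)
have [rs rsE] := closed_field_poly_normal (char_poly (map_mx (real_complex R) A)).
rewrite (monicP (char_poly_monic _)) scale1r in rsE.
have rsP l : (l \in rs) = eigenvalue (map_mx (real_complex R) A) l.
  by rewrite eigenvalue_root_char rsE root_prod_XsubC.
apply: (@le_lt_trans _ _ (\big[Num.max/0]_(l <- rs) Normc.normc l)).
  apply: ge_sup => // x [l /=]; rewrite -rsP => lrs <-.
  exact: le_bigmax_seq.
by rewrite big_seq; apply: bigmax_lt => // l; rewrite rsP => /eig_lt1.
Qed.

(** * Energy balance of the midpoint rule and its Cayley transform *)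

Section DissipativeMidpoint.
Variables (n : nat) (S N Ac : 'M[R]_n) (eps : R).
Hypotheses (Spos : loewner_lt 0 S) (SAc : S *m Ac = N) (eps_gt0 : 0 < eps).
Hypothesis Ndiss : forall x, dotv x (N *m x) <= - (eps * dotv x x).

(** The common core of both energy estimates, used at the state and at the midpoint: [SAc] absorbs
    [S] into [N], and transposing [B] and [S] turns the input term into output times input. *)
Lemma dissipative_power m (B : 'M[R]_(n, m)) x u :
  dotv x (S *m (Ac *m x + B *m u)) <=
  dotv (B^T *m S *m x) u - eps * dotv x x.
Proof.
have [_ SS _] := Spos.
rewrite mulmxDr dotvDr !mulmxA SAc addrC lerD ?Ndiss //.
by rewrite dotv_mulmxr trmx_mul SS.
Qed.

Lemma midpoint_energy_drop m (B : 'M[R]_(n, m)) h x y u :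
  0 < h -> let w := 2^-1 *: (y + x) in
  h^-1 *: (y - x) = Ac *m w + B *m u ->
  energy S y - energy S x <=
  h * dotv (B^T *m S *m w) u - h * eps * dotv w w.
Proof.
move=> h0 w step; have [_ SS _] := Spos.
rewrite energyB // -/w -[y - x](scalerKV (lt0r_neq0 h0)) step -scalemxAr dotvZr.
by rewrite -mulrA -mulrBr ler_pM2l // dissipative_power.
Qed.

(** A kernel vector satisfies [x = (h / 2) *: (Ac *m x)], so its positive energy product with [S]
    would be a positive multiple of the nonpositive [dotv x (N *m x)]. *)
Lemma resolvent_unitmx h : 0 < h -> 1%:M - (h / 2) *: Ac \in unitmx.
Proof.
move=> h0; apply: inj_unitmx => x.
rewrite mulmxBl mul1mx -scalemxAl => /eqP; rewrite subr_eq0 => /eqP xE.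
apply/eqP; apply: contraT => x0; have [_ _ /(_ _ x0)] := Spos.
rewrite subr0 {2}xE -scalemxAr dotvZr mulmxA SAc pmulr_rgt0 ?divr_gt0 // => Npos.
have := lt_le_trans Npos (Ndiss x).
by rewrite oppr_gt0 ltNge mulr_ge0 ?dotvv_ge0 // ltW.
Qed.

(** The vector [A *m x] is the midpoint step from [x] with zero input, so the energy drops by at
    least [h * eps] times the squared norm of the midpoint. *)
Lemma cayley_lyapunov h : 0 < h ->
  let A := invmx (1%:M - (h / 2) *: Ac) *m (1%:M + (h / 2) *: Ac) in
  loewner_lt (A^T *m S *m A - S) 0.
Proof.
move=> h0 A; have [_ SS _] := Spos; split; [|exact: trmx0|].
  have congr_sym (M : 'M[R]_n) : (M^T *m S *m M)^T = M^T *m S *m M.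
    by rewrite !trmx_mul trmxK SS mulmxA.
  by rewrite linearB /= SS congr_sym.
move=> x x0; set y := A *m x.
have yE : y - x = (h / 2) *: (Ac *m (y + x)).
  have : (1%:M - (h / 2) *: Ac) *m y = (1%:M + (h / 2) *: Ac) *m x.
    by rewrite /y /A !mulmxA mulmxV ?resolvent_unitmx // mul1mx.
  rewrite mulmxBl mulmxDl !mul1mx -!scalemxAl mulmxDr scalerDr.
  by move=> /(canRL (subrK _)) yE; rewrite [X in X - _]yE addrC !addrA addNr add0r addrC.
have step : h^-1 *: (y - x) = Ac *m (2^-1 *: (y + x)) + (0 : 'M[R]_n) *m (0 : 'cV[R]_n).
  rewrite mul0mx addr0 yE scalerA -scalemxAr; congr (_ *: _).
  by rewrite mulrA mulVf ?mul1r ?lt0r_neq0.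
have := midpoint_energy_drop h0 step.
rewrite dotv0r mulr0 sub0r => drop.
(* Strictness of the drop: a zero midpoint would give [y = - x], while [yE] would give [y = x],
   hence [x = 0]. *)
have w0 : 2^-1 *: (y + x) != 0.
  apply: contra x0; rewrite scaler_eq0 invr_eq0 pnatr_eq0 /= => /eqP yx0.
  move: yE; rewrite yx0 mulmx0 scaler0 => /eqP; rewrite subr_eq0 => /eqP yx.
  by move: yx0; rewrite yx -mulr2n -scaler_nat => /eqP; rewrite scaler_eq0 pnatr_eq0.
have {drop} : energy S y < energy S x.
  rewrite -subr_lt0; apply: (le_lt_trans drop).
  by rewrite oppr_lt0 !mulr_gt0 // dotvv_gt0.
rewrite /energy ltr_pM2l ?invr_gt0 // => yx.
by rewrite lyapunov_decrease subr_gt0.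
Qed.

End DissipativeMidpoint.

(** * Shifted Gram matrices, the common shape of [S] and [Rd] *)

Lemma gram_shift_sym n p (M : 'M[R]_(n, p)) e :
  (M *m M^T + e *: 1%:M)^T = M *m M^T + e *: 1%:M.
Proof. by rewrite linearD linearZ /= trmx1 trmx_mul trmxK. Qed.

Lemma scalar_loewner_gt0 n (e : R) : 0 < e -> loewner_lt 0 (e *: 1%:M : 'M[R]_n).
Proof.
move=> e0; split; [exact: trmx0|by rewrite linearZ /= trmx1|move=> x x0].
by rewrite subr0 -scalemxAl mul1mx dotvZr mulr_gt0 // dotvv_gt0.
Qed.

Lemma gram_shift_loewner_ge n p (M : 'M[R]_(n, p)) e :
  loewner_le (e *: 1%:M) (M *m M^T + e *: 1%:M).
Proof.
split; [by rewrite linearZ /= trmx1|exact: gram_shift_sym|move=> x].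
by rewrite addrK dotv_gram dotvv_ge0.
Qed.

Lemma gram_shift_loewner_gt0 n p (M : 'M[R]_(n, p)) e :
  0 < e -> loewner_lt 0 (M *m M^T + e *: 1%:M).
Proof.
move=> e0; split; [exact: trmx0|exact: gram_shift_sym|move=> x x0].
rewrite subr0 mulmxDl dotvDr dotv_gram ltr_wpDl ?dotvv_ge0 //.
by rewrite -scalemxAl mul1mx dotvZr mulr_gt0 // dotvv_gt0.
Qed.

End Stability.

Theorem mainTheorem4 (R : realType) (nq nphi m r : nat)
    (Sa : 'M[R]_(nq, m))
    (L K : 'M[R]_(lifted_dim nq nphi))
    (W : 'M[R]_(lifted_dim nq nphi, r))
    (eps_s eps_d h : R) :
  is_trig_mx L ->
  (r <= lifted_dim nq nphi)%N ->
  0 < eps_s ->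
  0 <= eps_d ->
  0 < h ->
  let I := 1%:M : 'M[R]_(lifted_dim nq nphi) in
  let S := L *m L^T + eps_s *: I in
  let J := K - K^T in
  let Rd := W *m W^T + eps_d *: I in
  let Ac := invmx S *m (J - Rd) in
  let Bc := lifted_input nphi Sa in
  let H := energy S in
  let A := invmx (I - (h / 2) *: Ac) *m (I + (h / 2) *: Ac) in
  0 < eps_d ->
  (loewner_le (eps_d *: I) Rd /\ loewner_lt 0 (eps_d *: I)) /\
  [/\ (* (i) *)
      forall (T : interval R) (u : R -> 'cV[R]_m)
             (z : R -> 'cV[R]_(lifted_dim nq nphi)),
        nondegenerate T ->
        is_solution Ac Bc T u z ->
        forall t : R, t \in T ->
          let y := Bc^T *m S *m z t in
          exists dH : R,
            is_derive_within T (H \o z : R -> R^o) t dH /\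
            dH <= dotv y (u t) - eps_d * norm2 (z t) ^+ 2,
      (* (ii) *)
      forall (z0 z1 : 'cV[R]_(lifted_dim nq nphi)) (u0 : 'cV[R]_m),
        let zbar := 2^-1 *: (z1 + z0) in
        let ybar := Bc^T *m S *m zbar in
        h^-1 *: (z1 - z0) = Ac *m zbar + Bc *m u0 ->
        H z1 - H z0 <= h * dotv ybar u0 - h * eps_d * norm2 zbar ^+ 2 &
      (* (iii) *)
      loewner_lt (A^T *m S *m A - S) 0 /\ spectral_radius A < 1].
Proof.
move=> _ _ eps_s0 _ h0 I S J Rd Ac Bc H A eps_d0.
have Spos : loewner_lt 0 S by exact: gram_shift_loewner_gt0.
have SAc : S *m Ac = J - Rd by rewrite mulmxA mulmxV ?mul1mx ?loewner_gt0_unitmx.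
(* The skew part [J] does no work and the Gram part of [Rd] is nonnegative; only the shift by
   [eps_d] remains. *)
have Ndiss x : dotv x ((J - Rd) *m x) <= - (eps_d * dotv x x).
  rewrite mulmxBl dotvDr dotv_skew add0r dotvNr lerN2 mulmxDl dotvDr dotv_gram.
  by rewrite -scalemxAl mul1mx dotvZr lerDr dotvv_ge0.
split; first by split; [exact: gram_shift_loewner_ge|exact: scalar_loewner_gt0].
have Alyap := cayley_lyapunov Spos SAc eps_d0 Ndiss h0.
split; last by split; [|exact: lyapunov_spectral_radius_lt1 Spos Alyap].
(* The witness is the product of [z t] with [S] times the velocity given by the equation. *)
- move=> T u z _ sol t tT y; exists (dotv (z t) (S *m (Ac *m z t + Bc *m u t))).
  split; last by rewrite norm2_sqr; exact: dissipative_power Spos SAc Ndiss _ _ _ _.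
  by have [_ SS _] := Spos; apply: is_derive_within_energy => //; exact: sol.
- by move=> z0 z1 u0 zbar ybar step; rewrite norm2_sqr; apply: (midpoint_energy_drop Spos SAc).
Qed.
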